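(* Let $n\ge2$, let $k\ge1$ and $l\in\{0,\dots,n-1\}$, and let $d=\gcd(k,n)$. When $d\mid l$, let $y=s_i$, $i=1,\dots,d$, be the $d$ solutions in $\{0,\dots,n-1\}$ of $ky\equiv l \bmod n$, ordered so that when $l=0$, $s_1=0$. Then the virtual Adams operations $\widetilde\psi^k:\mathcal{K}\to\mathcal{K}$ are given by 1. for $l\ne0$: $\widetilde\psi^k(1_{0l})=\sum_{i=1}^d1_{0s_i}$ if $d\mid l$, and $\widetilde\psi^k(1_{0l})=0$ if $d\nmid l$; 2. for $m\ne0$ and $l\neq0$: $\widetilde\psi^k(1_{ml})=\sum_{i=1}^d\dfrac{\zeta^{-l}-1}{\zeta^{-s_i}-1}\,1_{ms_i}$ if $d\mid l$, and $\widetilde\psi^k(1_{ml})=0$ if $d\nmid l$; 3. for $m\ne0$: $\widetilde\psi^k(1_{m0})=k\,1_{m0}$; 4. $\widetilde\psi^k(1_{00})=\sum_{i=1}^d1_{0s_i}$, with $s_i$ the solutions for $l=0$; 5. $\widetilde\psi^k(x_{00})=k\,x_{00}-(k-1)\,1_{00}+\sum_{i=2}^d1_{0s_i}$, with $s_i$ the solutions for $l=0$.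
   Context: **K-theory of the inertia of $\mathbb{P}(1,n)$.** Fix $n\ge2$, $\zeta=\exp(2\pi i/n)$, $G=\mathbb{C}^*$. Let $X=\mathbb{C}^2\setminus\{(0,0)\}$ with the action $\lambda\cdot(z_1,z_2)=(\lambda z_1,\lambda^n z_2)$; $\mathbb{P}(1,n)=[X/G]$. The inertia manifold is $I_GX=\coprod_{m\in\mathbb{Z}/n\mathbb{Z}}X^m$, with $X^m$ the fixed locus of $\zeta^m$, and $K(I\mathbb{P}(1,n))_{\mathbb{C}}=K_G(I_GX)\otimes\mathbb{C}$. As a vector space it is $\bigoplus_{m=0}^{n-1}A_m$ with $$A_0=\frac{\mathbb{C}[x_0^{\pm1}]}{\langle (x_0-1)(x_0^n-1)\rangle},\qquad A_m=\frac{\mathbb{C}[x_m^{\pm1}]}{\langle x_m^n-1\rangle}\quad(1\le m\le n-1).$$ The virtual Adams operations on $K(I\mathbb{P}(1,n))_{\mathbb{C}}$ are the $\mathbb{C}$-linear maps $\widetilde\psi^k$ ($k\ge1$) with, for $a\in\mathbb{Z}$, $\widetilde\psi^k(x_0^a)=x_0^{ka}$ and $\widetilde\psi^k(x_m^a)=x_m^{ka}\cdot\sum_{i=0}^{k-1}x_m^{-i}$ for $m\ne0$, where the product is the ordinary one in $A_m$. **Localization.** For $m,l\in\{0,\dots,n-1\}$ let $I_{00}=\langle(x_{00}-1)^2\rangle$ and $I_{ml}=\langle x_{ml}-\zeta^l\rangle$ for $(m,l)\ne(0,0)$. Put $\mathcal{K}=\bigoplus_{m,l}\mathbb{C}[x_{ml}^{\pm1}]/I_{ml}$;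 $1_{ml}$ is the identity of the $(m,l)$ summand. The map $\Gamma:K(I\mathbb{P}(1,n))_{\mathbb{C}}\to\mathcal{K}$ sends $f(x_m)\in A_m$ to the tuple of classes of $f(x_{ml})$, $l=0,\dots,n-1$; it is an isomorphism of vector spaces. The virtual Adams operations on $\mathcal{K}$ are the transported maps $\Gamma\circ\widetilde\psi^k\circ\Gamma^{-1}$, again denoted $\widetilde\psi^k$. *)

(* Defs.v *)
From HB Require Import structures.
From mathcomp Require Import all_boot all_order all_algebra.
From mathcomp Require Import finmap monalg complex.
From mathcomp Require Import boolp classical_sets functions reals trigo.
From mathcomp Require Import zify ring lra.

Set Implicit Arguments.
Unset Strict Implicit.
Unset Printing Implicit Defensive.

Import Order.TTheory GRing.Theory Num.Theory.
Local Open Scope fset_scope.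
Local Open Scope ring_scope.

(* MathComp has no Laurent polynomials, and multinomials only makes {malg F[K]}
   a ring when K has no invertible element other than its unit, so the
   convolution product on {malg F[int]} is defined here. *)
Definition laurent (F : fieldType) : Type := {malg F[int]}.

HB.instance Definition _ (F : fieldType) := GRing.Lmodule.on (laurent F).

Definition xpow {F : fieldType} (a : int) : laurent F := << a >>.

(* The linear map laurent F -> V with x^a |-> g a. *)
Definition lext {F : fieldType} {V : lmodType F} (g : int -> V)
  (f : laurent F) : V := \sum_(a <- msupp f) f@_a *: g a.

Section LinearExtension.
Variables (F : fieldType).
Implicit Types (f h : laurent F).

Lemma lextw (V : lmodType F) (g : int -> V) f (d : {fset int}) :
  msupp f `<=` d -> lext g f = \sum_(a <- d) f@_a *: g a.
Proof.
move=> le_fd; apply: big_fset_incl => // a _ /mcoeff_outdom ->.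
by rewrite scale0r.
Qed.

Lemma lextP (V : lmodType F) (g : int -> V) c f h :
  lext g (c *: f + h) = c *: lext g f + lext g h.
Proof.
have hf : msupp f `<=` msupp f `|` msupp h by apply: fsubsetUl.
have hh : msupp h `<=` msupp f `|` msupp h by apply: fsubsetUr.
have hfh : msupp (c *: f + h : {malg F[int]}) `<=` msupp f `|` msupp h.
  apply: fsubset_trans (msuppD_le _ _) _.
  by apply: fsetSU; apply: msuppZ_le.
rewrite (lextw g hf) (lextw g hh) (lextw g hfh) scaler_sumr -big_split /=.
by apply: eq_bigr => a _; rewrite mcoeffD mcoeffZ scalerDl scalerA.
Qed.

HB.instance Definition _ (V : lmodType F) (g : int -> V) :=
  GRing.isLinear.Build F (laurent F) V *:%R (lext g) (lextP g).

Lemma lext_xpow (V : lmodType F) (g : int -> V) a : lext g (xpow a) = g a.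
Proof.
by rewrite (lextw g msuppU_le) big_seq_fset1 mcoeffUU scale1r.
Qed.

Lemma laurentE f : f = \sum_(a <- msupp f) f@_a *: xpow a.
Proof.
rewrite [LHS]monalgE; apply: eq_bigr => a _.
by apply/malgP => b; rewrite mcoeffZ !mcoeffU mulr_natr.
Qed.

Lemma laurent_ind (P : laurent F -> Prop) :
  P 0 -> (forall c f h, P f -> P h -> P (c *: f + h)) ->
  (forall a, P (xpow a)) -> forall f, P f.
Proof.
move=> P0 PD PX f; rewrite [f]laurentE.
elim/big_rec: _ => // a h _ Ph; exact: PD.
Qed.

Definition lone : laurent F := xpow 0.
Definition lmul f h : laurent F :=
  lext (fun a => lext (fun b => xpow (a + b)) h) f.

Lemma lmulPl h c f1 f2 : lmul (c *: f1 + f2) h = c *: lmul f1 h + lmul f2 h.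
Proof. exact: linearP. Qed.

Lemma lmulC : commutative lmul.
Proof.
move=> f h; rewrite /lmul /lext.
under eq_bigr do rewrite scaler_sumr.
rewrite exchange_big /=; apply: eq_bigr => b _.
rewrite scaler_sumr; apply: eq_bigr => a _.
by rewrite !scalerA mulrC addrC.
Qed.

Lemma lmulPr h c f1 f2 : lmul h (c *: f1 + f2) = c *: lmul h f1 + lmul h f2.
Proof. by rewrite ![lmul h _]lmulC lmulPl. Qed.

Lemma lmul0 h : lmul h 0 = 0.
Proof. by rewrite lmulC /lmul linear0. Qed.

Lemma lmulXX a b : lmul (xpow a) (xpow b) = xpow (a + b).
Proof. by rewrite /lmul !lext_xpow. Qed.

Lemma lmulA : associative lmul.
Proof.
move=> f g h; elim/laurent_ind: f => [|c f1 f2 IH1 IH2|a].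
- by rewrite ![lmul 0 _]lmulC !lmul0 lmulC lmul0.
- by rewrite !lmulPl IH1 IH2.
elim/laurent_ind: g => [|c g1 g2 IH1 IH2|b].
- by rewrite lmul0 [lmul 0 _]lmulC !lmul0.
- by rewrite !(lmulPl, lmulPr) IH1 IH2.
elim/laurent_ind: h => [|c h1 h2 IH1 IH2|d].
- by rewrite !lmul0.
- by rewrite !lmulPr IH1 IH2.
by rewrite !lmulXX addrA.
Qed.

Lemma lmul1 : left_id lone lmul.
Proof.
move=> f; elim/laurent_ind: f => [|c f1 f2 IH1 IH2|a].
- exact: lmul0.
- by rewrite lmulPr IH1 IH2.
by rewrite lmulXX add0r.
Qed.

Lemma lmulDl : left_distributive lmul +%R.
Proof. by move=> f1 f2 h; rewrite -[f1]scale1r lmulPl !scale1r. Qed.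

Lemma lone_neq0 : lone != 0.
Proof. by rewrite monalgU_eq0 oner_eq0. Qed.

End LinearExtension.

HB.instance Definition _ (F : fieldType) :=
  GRing.Zmodule_isComNzRing.Build (laurent F)
    (@lmulA F) (@lmulC F) (@lmul1 F) (@lmulDl F) (@lone_neq0 F).

Lemma laurent_scaleAl (F : fieldType) (c : F) (f h : laurent F) :
  c *: (f * h) = (c *: f) * h.
Proof. by symmetry; apply: linearZ. Qed.

HB.instance Definition _ (F : fieldType) :=
  GRing.Lmodule_isLalgebra.Build F (laurent F) (@laurent_scaleAl F).
HB.instance Definition _ (F : fieldType) :=
  GRing.Lalgebra_isComAlgebra.Build F (laurent F).

Lemma xpowD (F : fieldType) (a b : int) :
  xpow (a + b) = xpow a * xpow b :> laurent F.
Proof. by rewrite [RHS]lmulXX. Qed.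

Lemma xpow0 (F : fieldType) : xpow 0 = 1 :> laurent F.
Proof. by []. Qed.

(* The ideal generated by p. *)
Definition principal (F : fieldType) (p : laurent F) : {pred laurent F} :=
  [pred f | `[< exists h, f = h * p >] ].

Section Quotient.
Variables (F : fieldType) (p : laurent F).

Lemma principalP f : reflect (exists h, f = h * p) (f \in principal p).
Proof. exact: asboolP. Qed.

Lemma principal_zmod : zmod_closed (principal p).
Proof.
split; first by apply/principalP; exists 0; rewrite mul0r.
move=> f g /principalP[a ->] /principalP[b ->].
by apply/principalP; exists (a - b); rewrite mulrBl.
Qed.

HB.instance Definition _ :=
  GRing.isZmodClosed.Build (laurent F) (principal p) principal_zmod.

Lemma principalM f g : g \in principal p -> f * g \in principal p.
Proof.
by move=> /principalP[h ->]; apply/principalP; exists (f * h); rewrite mulrA.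
Qed.

Definition lquot : Type := Quotient.quot (principal p).

HB.instance Definition _ := GRing.Zmodule.on lquot.

Definition cls (f : laurent F) : lquot :=
  \pi_(Quotient.quot (principal p))%qT f.
Definition lrepr (u : lquot) : laurent F :=
  @generic_quotient.repr _ (Quotient.quot (principal p)) u.

Lemma lreprK : cancel lrepr cls.
Proof. by move=> u; apply: generic_quotient.reprK. Qed.

Lemma cls_eqP f g : reflect (cls f = cls g) (f - g \in principal p).
Proof. by rewrite Quotient.idealrBE; apply: eqP. Qed.

Lemma clsB : zmod_morphism cls.
Proof. by move=> f g; apply: raddfB. Qed.

HB.instance Definition _ :=
  GRing.isZmodMorphism.Build (laurent F) lquot cls clsB.

Lemma lrepr_cls f : lrepr (cls f) - f \in principal p.
Proof. by apply/cls_eqP; rewrite lreprK. Qed.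

Definition qscale (c : F) (u : lquot) : lquot := cls (c *: lrepr u).
Definition qmul (u v : lquot) : lquot := cls (lrepr u * lrepr v).

Lemma qscaleE c f : qscale c (cls f) = cls (c *: f).
Proof.
apply/cls_eqP; rewrite -scalerBr -mulr_algl.
by apply: principalM; apply: lrepr_cls.
Qed.

Lemma qmulE f g : qmul (cls f) (cls g) = cls (f * g).
Proof.
apply/cls_eqP.
have -> : lrepr (cls f) * lrepr (cls g) - f * g =
    lrepr (cls f) * (lrepr (cls g) - g) + g * (lrepr (cls f) - f).
  by rewrite !mulrBr addrA [g * lrepr _]mulrC subrK [g * f]mulrC.
by apply: rpredD; apply: principalM; apply: lrepr_cls.
Qed.

Lemma qscaleA a b u : qscale a (qscale b u) = qscale (a * b) u.
Proof. by rewrite -[u]lreprK !qscaleE scalerA. Qed.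

Lemma qscale1 : left_id 1 qscale.
Proof. by move=> u; rewrite -[u]lreprK qscaleE scale1r. Qed.

Lemma qscaleDr : right_distributive qscale +%R.
Proof.
move=> c u v; rewrite -[u]lreprK -[v]lreprK.
by rewrite -raddfD !qscaleE scalerDr raddfD.
Qed.

Lemma qscaleDl u : {morph qscale^~ u : a b / a + b}.
Proof.
by move=> a b; rewrite -[u]lreprK !qscaleE scalerDl raddfD.
Qed.

HB.instance Definition _ :=
  GRing.Zmodule_isLmodule.Build F lquot qscaleA qscale1 qscaleDr qscaleDl.

Lemma qmulA : associative qmul.
Proof.
by move=> u v w; rewrite -[u]lreprK -[v]lreprK -[w]lreprK !qmulE mulrA.
Qed.

Lemma qmulC : commutative qmul.
Proof. by move=> u v; rewrite -[u]lreprK -[v]lreprK !qmulE mulrC. Qed.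

Lemma qmul1 : left_id (cls 1) qmul.
Proof. by move=> u; rewrite -[u]lreprK !qmulE mul1r. Qed.

Lemma qmulDl : left_distributive qmul +%R.
Proof.
move=> u v w; rewrite -[u]lreprK -[v]lreprK -[w]lreprK.
by rewrite -raddfD !qmulE mulrDl raddfD.
Qed.

(* A possibly trivial ring, since p may be invertible. *)
HB.instance Definition _ :=
  GRing.Zmodule_isComPzRing.Build lquot qmulA qmulC qmul1 qmulDl.

Lemma qscaleAl (c : F) (u v : lquot) : c *: (u * v) = (c *: u) * v.
Proof.
rewrite -[u]lreprK -[v]lreprK.
by rewrite [_ * _]qmulE [_ *: cls _]qscaleE [c *: cls (lrepr u)]qscaleE
  [RHS]qmulE scalerAl.
Qed.

Lemma clsZ : scalable cls.
Proof. by move=> c f; rewrite -qscaleE. Qed.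

HB.instance Definition _ := GRing.isScalable.Build F (laurent F) lquot *:%R cls clsZ.

Lemma lrepr_linear (c : F) (u v : lquot) :
  lrepr (c *: u + v) - (c *: lrepr u + lrepr v) \in principal p.
Proof. by apply/cls_eqP; rewrite linearP /= !lreprK. Qed.

Lemma cls_monoid_morphism : monoid_morphism cls.
Proof. by split=> // f g; rewrite -qmulE. Qed.

HB.instance Definition _ :=
  GRing.isMonoidMorphism.Build (laurent F) lquot cls cls_monoid_morphism.

End Quotient.

(* The external direct sum of a finite family of vector spaces. *)
Definition dirsum (F : fieldType) (I : finType) (V : I -> lmodType F) : Type :=
  forall i, V i.

Section DirectSum.
Variables (F : fieldType) (I : finType) (V : I -> lmodType F).
Local Notation D := (dirsum V).
Implicit Types u v w : D.

HB.instance Definition _ := Choice.copy D (forall i, V i).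

Definition dzero : D := fun=> 0.
Definition dopp u : D := fun i => - u i.
Definition dadd u v : D := fun i => u i + v i.
Definition dscale c u : D := fun i => c *: u i.

Lemma daddA : associative dadd.
Proof. by move=> u v w; apply: functional_extensionality_dep => i; apply: addrA. Qed.

Lemma daddC : commutative dadd.
Proof. by move=> u v; apply: functional_extensionality_dep => i; apply: addrC. Qed.

Lemma dadd0 : left_id dzero dadd.
Proof. by move=> u; apply: functional_extensionality_dep => i; apply: add0r. Qed.

Lemma daddN : left_inverse dzero dopp dadd.
Proof. by move=> u; apply: functional_extensionality_dep => i; apply: addNr. Qed.

HB.instance Definition _ := GRing.isZmodule.Build D daddA daddC dadd0 daddN.

Lemma dscaleA a b u : dscale a (dscale b u) = dscale (a * b) u.
Proof. by apply: functional_extensionality_dep => i; apply: scalerA. Qed.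

Lemma dscale1 : left_id 1 dscale.
Proof. by move=> u; apply: functional_extensionality_dep => i; apply: scale1r. Qed.

Lemma dscaleDr : right_distributive dscale +%R.
Proof. by move=> c u v; apply: functional_extensionality_dep => i; apply: scalerDr. Qed.

Lemma dscaleDl u : {morph dscale^~ u : a b / a + b}.
Proof. by move=> a b; apply: functional_extensionality_dep => i; apply: scalerDl. Qed.

HB.instance Definition _ :=
  GRing.Zmodule_isLmodule.Build F D dscaleA dscale1 dscaleDr dscaleDl.

End DirectSum.

Section Zeta.
Variables (R : realType) (n : nat).
Local Notation C := R[i].

(* exp(2 i pi / n), through Euler's formula *)
Definition zeta : C :=
  (cos (2 * pi / n%:R) +i* sin (2 * pi / n%:R))%C.

Lemma zetaX k : zeta ^+ k =
  (cos (2 * pi / n%:R *+ k) +i* sin (2 * pi / n%:R *+ k))%C.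
Proof.
elim: k => [|k IH]; first by rewrite expr0 mulr0n cos0 sin0.
rewrite exprS IH /zeta; set t := 2 * pi / n%:R.
rewrite (mulrS t k) cosD sinD.
by apply/eqP; rewrite eq_complex /= [X in _ && (_ == X)]addrC !eqxx.
Qed.

Lemma zeta_prim : (0 < n)%N -> n.-primitive_root zeta.
Proof.
move=> n_gt0.
have nn0 : n%:R != 0 :> R by rewrite pnatr_eq0 -lt0n.
have zn1 : zeta ^+ n = 1.
  rewrite zetaX -mulr_natr mulfVK // mulr_natl.
  by rewrite cos2pi sin2pi.
have [m pm mn] := prim_order_exists n_gt0 zn1.
suff mn' : m = n by rewrite mn' in pm.
apply/eqP; rewrite eqn_leq dvdn_leq //= leqNgt.
apply/negP => mltn.
have m_gt0 := prim_order_gt0 pm.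
have := congr1 (@complex.Re R) (prim_expr_order pm); rewrite zetaX /=.
set t := _ *+ m.
have tE : t = (pi * (m%:R / n%:R)) *+ 2.
  by rewrite /t -(mulr_natr _ m) -(mulr_natr _ 2); ring.
rewrite tE cos_mulr2n => h3.
have : 0 < sin (pi * (m%:R / n%:R) : R).
  apply: sin_gt0_pi.
  rewrite mulr_gt0 ?pi_gt0 ?divr_gt0 ?ltr0n //=.
  by rewrite gtr_pMr ?pi_gt0 // ltr_pdivrMr ?ltr0n // mul1r ltr_nat.
have := cos2Dsin2 (pi * (m%:R / n%:R) : R).
move=> h1 h2.
have : sin (pi * (m%:R / n%:R) : R) ^+ 2 = 0.
  by move: h1 h3; rewrite -(mulr_natr _ 2); lra.
by move/eqP; rewrite sqrf_eq0 gt_eqF.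
Qed.

End Zeta.

Section InertiaKTheory.
Variables (F : fieldType) (n : nat).

Definition relA (m : nat) : laurent F :=
  if m == 0%N then (xpow 1 - 1) * (xpow n - 1) else xpow n - 1.

Definition Am (m : nat) := lquot (relA m).

(* x_m^a *)
Definition xA (m : nat) (a : int) : Am m := cls (relA m) (xpow a).

(* The value of the m-th virtual Adams operation at x_m^a. *)
Definition adams_xA (k m : nat) (a : int) : Am m :=
  xA m (k%:Z * a) * (if m == 0%N then 1 else \sum_(i < k) xA m (- i%:Z)).

(* The linear extension of adams_xA, evaluated at a representative; by
   adamsA_cls below the choice of the representative does not matter. *)
Definition adamsA (k m : nat) (u : Am m) : Am m := lext (adams_xA k m) (lrepr u).

Definition KI := dirsum (fun m : 'I_n => Am m).

Definition adamsKI (k : nat) (u : KI) : KI := fun m => adamsA k (u m).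

Implicit Types (f g h : laurent F).

Lemma xpowMn (a : int) k : xpow (a * k%:Z) = xpow a ^+ k :> laurent F.
Proof.
elim: k => [|k IH]; first by rewrite mulr0.
by rewrite exprS -IH -xpowD intS mulrDr mulr1.
Qed.

(* f(x) |-> f(x^k) *)
Definition subst (k : nat) : laurent F -> laurent F :=
  lext (fun a => xpow (k%:Z * a)).

Lemma substX k a : subst k (xpow a) = xpow (k%:Z * a).
Proof. exact: lext_xpow. Qed.

Lemma subst1 k : subst k 1 = 1.
Proof. by rewrite -xpow0 substX mulr0. Qed.

Lemma substP k c f g : subst k (c *: f + g) = c *: subst k f + subst k g.
Proof. exact: lextP. Qed.

Lemma substB k f g : subst k (f - g) = subst k f - subst k g.
Proof. exact: linearB. Qed.

Lemma subst0 k : subst k 0 = 0.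
Proof. exact: linear0. Qed.

Lemma substM k f g : subst k (f * g) = subst k f * subst k g.
Proof.
elim/laurent_ind: f => [|c f1 f2 IH1 IH2|a].
- by rewrite mul0r subst0 mul0r.
- by rewrite mulrDl -scalerAl !substP IH1 IH2 mulrDl scalerAl.
elim/laurent_ind: g => [|c g1 g2 IH1 IH2|b].
- by rewrite mulr0 subst0 mulr0.
- by rewrite mulrDr -scalerAr !substP IH1 IH2 mulrDr scalerAr.
by rewrite -xpowD !substX mulrDr xpowD.
Qed.

Lemma subst_subX1 k a : exists h, subst k (xpow a - 1) = h * (xpow a - 1).
Proof.
rewrite substB substX subst1 mulrC xpowMn subrX1.
by rewrite mulrC; eexists.
Qed.

Lemma subst_relA k m f :
  f \in principal (relA m) -> subst k f \in principal (relA m).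
Proof.
move=> /principalP[h ->]; rewrite substM; apply: principalM.
apply/principalP; rewrite /relA; case: ifP => _; last exact: subst_subX1.
have [a ha] := subst_subX1 k 1; have [b hb] := subst_subX1 k n.
exists (a * b); rewrite substM ha hb; exact: mulrACA.
Qed.

Lemma adams_xAE k m f : lext (adams_xA k m) f =
  cls (relA m) (subst k f) *
    (if m == 0%N then 1 else \sum_(i < k) xA m (- i%:Z)).
Proof.
elim/laurent_ind: f => [|c f1 f2 IH1 IH2|a].
- by rewrite linear0 subst0 raddf0 mul0r.
- by rewrite lextP IH1 IH2 substP linearP mulrDl qscaleAl.
by rewrite lext_xpow substX.
Qed.

Lemma adamsA_cls k m f :
  adamsA k (cls (relA m) f) = lext (adams_xA k m) f.
Proof.
rewrite /adamsA !adams_xAE; congr (_ * _); apply/cls_eqP.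
by rewrite -substB; apply: subst_relA; apply: lrepr_cls.
Qed.

Lemma adamsA_linear k m : linear (@adamsA k m).
Proof.
move=> c u v; rewrite -[u]lreprK -[v]lreprK -linearP !adamsA_cls.
exact: lextP.
Qed.

Lemma adamsA_xA k m a : adamsA k (xA m a) = adams_xA k m a.
Proof. by rewrite adamsA_cls lext_xpow. Qed.

Lemma adamsKI_linear k : linear (@adamsKI k).
Proof.
move=> c u v; apply: functional_extensionality_dep => m.
exact: adamsA_linear.
Qed.

End InertiaKTheory.

Section ChineseRemainder.
Variable L : comNzRingType.
Implicit Types (p r f : L) (q g : nat -> L).

Definition comax p r := exists u v, u * p + v * r = 1.

Lemma comax_sym p r : comax p r -> comax r p.
Proof. by move=> [u [v e]]; exists v, u; rewrite addrC. Qed.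

Lemma comaxM p r s : comax p r -> comax p s -> comax p (r * s).
Proof.
move=> [u [v e]] [u' [v' e']].
exists (u * u' * p + u * v' * s + v * r * u'), (v * v').
have : (u * p + v * r) * (u' * p + v' * s) = 1 by rewrite e e' mulr1.
by move=> <-; ring.
Qed.

Lemma comax_prod p q k : (forall i, (i < k)%N -> comax p (q i)) ->
  comax p (\prod_(0 <= i < k) q i).
Proof.
elim: k => [|k IH] h.
  by rewrite big_geq //; exists 0, 1; rewrite mul0r mulr1 add0r.
rewrite big_nat_recr //=; apply: comaxM; last exact: h.
by apply: IH => i ik; apply: h; apply: ltnW.
Qed.

Definition pairwise_comax q k :=
  forall i j, (i < j < k)%N -> comax (q i) (q j).

Lemma pairwise_comaxS q k : pairwise_comax q k.+1 ->
  pairwise_comax q k /\ comax (q k) (\prod_(0 <= i < k) q i).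
Proof.
move=> h; split=> [i j /andP[ij jk]|].
  by apply: h; rewrite ij /= ltnW.
by apply: comax_prod => i ik; apply: comax_sym; apply: h; rewrite ik /=.
Qed.

Lemma crt_inj q k f : pairwise_comax q k ->
  (forall i, (i < k)%N -> exists h, f = h * q i) ->
  exists h, f = h * \prod_(0 <= i < k) q i.
Proof.
elim: k => [|k IH] hq hf; first by exists f; rewrite big_geq // mulr1.
have [hq' [u [v e]]] := pairwise_comaxS hq.
have [a fa] := IH hq' (fun i ik => hf i (ltnW ik)).
have [b fb] := hf k (leqnn _).
exists (a * u + b * v); rewrite big_nat_recr //=.
set P := (X in _ * (X * _)); rewrite -[f]mulr1 -e mulrDr {1}fa fb /P.
by ring.
Qed.

Lemma crt_surj q g k : pairwise_comax q k ->
  exists f, forall i, (i < k)%N -> exists h, f - g i = h * q i.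
Proof.
elim: k => [|k IH] hq; first by exists 0.
have [hq' [u [v e]]] := pairwise_comaxS hq.
have [f hf] := IH hq'.
exists (f * (u * q k) + g k * (v * \prod_(0 <= i < k) q i)) => i.
rewrite ltnS leq_eqVlt => /orP[/eqP->|ik].
  exists ((f - g k) * u).
  have -> : v * \prod_(0 <= i0 < k) q i0 = 1 - u * q k
    by rewrite -[X in X - _]e addrAC subrr add0r.
  by ring.
have [h hh] := hf i ik.
have -> : u * q k = 1 - v * \prod_(0 <= i0 < k) q i0
  by rewrite -[X in X - _]e addrK.
rewrite (bigD1_seq i) ?mem_index_iota ?iota_uniq //=.
set P := \prod_(_ <- _ | _) _.
exists (h + (g k - f) * v * P).
have -> : f = g i + h * q i by rewrite -hh; ring.
by ring.
Qed.

End ChineseRemainder.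

Section Localization.
Variables (F : fieldType) (n : nat) (z : F).

Definition relK (m l : nat) : laurent F :=
  if (m == 0%N) && (l == 0%N) then (xpow 1 - 1) ^+ 2
  else xpow 1 - (z ^+ l)%:A.

Definition KK := dirsum (fun ml : 'I_n * 'I_n => lquot (relK ml.1 ml.2)).

(* By Gamma_cls below the choice of the representative does not matter. *)
Definition Gamma (u : KI F n) : KK :=
  fun ml => cls (relK ml.1 ml.2) (lrepr (u ml.1)).

(* The two-sided inverse of Gamma when z is a primitive n-th root of unity, by
   Gamma_invK below; in particular when z = zeta R n, by zeta_prim. *)
Definition Gamma_inv : KK -> KI F n := 'pinv_(fun=> 0) [set: KI F n] Gamma.

Definition adams (k : nat) : KK -> KK := Gamma \o @adamsKI F n k \o Gamma_inv.

(* f(x_ml) in the summand of index (m, l), where m, l < n; this is 0 when m or l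
   is out of range. *)
Definition inK (m l : nat) (f : laurent F) : KK :=
  fun ml => cls (relK ml.1 ml.2)
    (if (ml.1 == m :> nat) && (ml.2 == l :> nat) then f else 0).

Definition oneK (m l : nat) : KK := inK m l 1.
Definition x00 : KK := inK 0 0 (xpow 1).

Context (z_prim : n.-primitive_root z).
Let n_gt0 : (0 < n)%N := prim_order_gt0 z_prim.

Lemma comax_relK m : pairwise_comax (relK m) n.
Proof.
have H a b : a != b -> comax (xpow 1 - a%:A : laurent F) (xpow 1 - b%:A).
  move=> ab; exists ((b - a)^-1%:A), (- (b - a)^-1%:A).
  rewrite mulNr -mulrBr.
  have -> : xpow 1 - a%:A - (xpow 1 - b%:A) = (b - a)%:A :> laurent F.
    by rewrite scalerBl opprB addrC addrA subrK.
  by rewrite -scalerAl mul1r scalerA mulVf ?scale1r // subr_eq0 eq_sym.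
have z1 l : (0 < l < n)%N -> 1 != z ^+ l.
  move=> /andP[l0 ln]; rewrite eq_sym -(prim_order_dvd z_prim).
  by apply/negP => /(dvdn_leq l0); rewrite leqNgt ln.
move=> i j /andP[ij jn].
rewrite /relK; have /negPf-> : j != 0%N by rewrite -lt0n (leq_ltn_trans _ ij).
rewrite andbF; case: ifP => [/andP[_ /eqP i0]|_].
  rewrite expr2; apply: comax_sym.
  have zj : z ^+ j != 1 by rewrite eq_sym z1 // jn andbT -i0.
  have := H _ _ zj; rewrite scale1r => h1; exact (comaxM h1 h1).
apply: H; rewrite (eq_prim_root_expr z_prim).
by rewrite !modn_small ?(ltn_trans ij) // ltn_eqF.
Qed.

Lemma xpowN1_prod :
  xpow n - 1 = \prod_(0 <= l < n) (xpow 1 - (z ^+ l)%:A) :> laurent F.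
Proof.
have := congr1 (horner_alg (xpow 1 : laurent F)) (factor_Xn_sub_1 z_prim).
rewrite rmorph_prod rmorphB rmorph1 rmorphXn /= horner_algX -xpowMn mul1r => <-.
by apply: eq_bigr => l _; rewrite rmorphB /= horner_algX horner_algC.
Qed.

Lemma relA_prod m : relA F n m = \prod_(0 <= l < n) relK m l.
Proof.
rewrite /relA xpowN1_prod; case: ifP => [/eqP->|m0].
  rewrite (big_ltn n_gt0) [RHS](big_ltn n_gt0) expr0 scale1r mulrA -expr2.
  rewrite {1}/relK eqxx andbT; apply: (congr1 (fun f => _ * f)).
  apply: eq_big_nat => l /andP[l0 _].
  by rewrite /relK eqxx /= -[X in if X then _ else _]negbK -lt0n l0.
by apply: eq_bigr => l _; rewrite /relK m0.
Qed.

Lemma relA_relK m l f : (l < n)%N ->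
  f \in principal (relA F n m) -> f \in principal (relK m l).
Proof.
move=> ln /principalP[h ->]; rewrite relA_prod.
rewrite (bigD1_seq l) ?mem_index_iota ?iota_uniq //= mulrCA mulrC.
by apply/principalP; eexists.
Qed.

Lemma relK_relA m f :
  (forall l, (l < n)%N -> f \in principal (relK m l)) ->
  f \in principal (relA F n m).
Proof.
move=> hf; apply/principalP; rewrite relA_prod.
apply: (crt_inj (@comax_relK m)) => l ln; apply/principalP.
exact: hf.
Qed.

Lemma Gamma_cls (f : 'I_n -> laurent F) :
  Gamma ((fun m => cls (relA F n m) (f m)) : KI F n) =
  fun ml => cls (relK ml.1 ml.2) (f ml.1).
Proof.
apply: functional_extensionality_dep => -[m l] /=.
by apply/cls_eqP; apply: relA_relK => //; apply: lrepr_cls.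
Qed.

Lemma Gamma_linear : linear Gamma.
Proof.
move=> c u v; apply: functional_extensionality_dep => -[m l].
rewrite [RHS]/= /Gamma /=.
rewrite -[RHS](linearP (cls (relK m l))).
apply/cls_eqP; apply: relA_relK => //.
exact: lrepr_linear.
Qed.

Lemma Gamma_invK : cancel Gamma Gamma_inv /\ cancel Gamma_inv Gamma.
Proof.
have inj : injective Gamma.
  move=> u v uv; apply: functional_extensionality_dep => m.
  rewrite -[u m]lreprK -[v m]lreprK; apply/cls_eqP.
  apply: relK_relA => l ln; apply/cls_eqP.
  exact: (congr1 (fun w : KK => w (m, Ordinal ln)) uv).
have surj w : exists u, Gamma u = w.
  pose g (m : 'I_n) (l : nat) : laurent F :=
    if insub l is Some l' then lrepr (w (m, l')) else 0.
  have hf (m : 'I_n) := crt_surj (g m) (@comax_relK m).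
  exists (fun m => cls _ (projT1 (cid (hf m)))).
  rewrite Gamma_cls; apply: functional_extensionality_dep => -[m l].
  rewrite -[RHS]lreprK; apply/cls_eqP/principalP => /=.
  case: cid => f hfm /=; have := hfm l (ltn_ord l).
  by rewrite /g valK.
split.
  move=> u; apply: (@pinvKV _ _ (fun=> 0) [set: KI F n] Gamma).
    by move=> x y _ _; apply: inj.
  by rewrite inE.
move=> w; apply: (@pinvK _ _ (fun=> 0) [set: KI F n] Gamma).
by rewrite inE; have [u uw] := surj w; exists u.
Qed.

Lemma Gamma_bij : bijective Gamma.
Proof. by exists Gamma_inv; case: Gamma_invK. Qed.

End Localization.

Arguments KK {F} n z.
Arguments adams {F} n z k _.
Arguments inK {F} n z m l f.
Arguments oneK {F} n z m l.
Arguments x00 {F} n z.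

(* s 1, ..., s (gcdn k n) are the solutions of k y = l mod n in {0, ..., n-1},
   each listed once, with s 1 = 0 when l = 0. *)
Definition solutions (n k l : nat) (s : nat -> nat) : Prop :=
  [/\ forall i, (1 <= i <= gcdn k n)%N -> (s i < n)%N /\ k * s i = l %[mod n],
      {in [pred i | 1 <= i <= gcdn k n]%N &, injective s},
      forall y, (y < n)%N -> k * y = l %[mod n] ->
        exists2 i, (1 <= i <= gcdn k n)%N & s i = y
    & l = 0%N -> s 1%N = 0%N].

Lemma solutions_exist (n k l : nat) : (0 < n)%N -> (0 < k)%N ->
  (gcdn k n %| l)%N -> exists s, solutions n k l s.
Proof.
move=> n0 k0 /dvdnP[l' ->].
rewrite /solutions; set d := gcdn k n.
have d0 : (0 < d)%N by rewrite gcdn_gt0 k0.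
have /dvdnP[k' kE] : (d %| k)%N by apply: dvdn_gcdl.
have /dvdnP[n' nE] : (d %| n)%N by apply: dvdn_gcdr.
have k'0 : (0 < k')%N by move: k0; rewrite kE muln_gt0 => /andP[].
have n'0 : (0 < n')%N by move: n0; rewrite nE muln_gt0 => /andP[].
have cop : coprime k' n'.
  by rewrite /coprime -(eqn_pmul2r d0) mul1n muln_gcdl -kE -nE.
have [u v uv _] := egcdnP n' k'0; rewrite (eqP cop) in uv.
have modE y : (k * y = l' * d %[mod n]) <-> (y = u * l' %[mod n']).
  have -> : (k * y = d * (k' * y))%N by rewrite kE mulnCA mulnA.
  have -> : (l' * d = d * l')%N by rewrite mulnC.
  have -> : (n = d * n')%N by rewrite nE mulnC.
  rewrite -!muln_modr.
  split=> [/eqP|e].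
    rewrite eqn_pmul2l // => /eqP e.
    have : (u * (k' * y) = u * l' %[mod n'])%N.
      by rewrite -modnMmr e modnMmr.
    by rewrite mulnA uv mulnDl mul1n mulnAC modnMDl.
  congr (_ * _)%N; rewrite -modnMmr e modnMmr mulnA [(k' * u)%N]mulnC uv.
  by rewrite mulnDl mul1n mulnAC modnMDl.
have ltE i : (1 <= i <= d)%N -> ((i.-1) * n' + (u * l') %% n' < n)%N.
  move=> /andP[i1 id]; have := ltn_pmod (u * l') n'0.
  rewrite nE; nia.
exists (fun i => i.-1 * n' + (u * l') %% n')%N; split.
- by move=> i /ltE; split=> //; apply/modE; rewrite modnMDl modn_mod.
- move=> i j /andP[i1 _] /andP[j1 _] /addIn /eqP.
  by rewrite eqn_pmul2r // => /eqP; lia.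
- move=> y yn /modE e; exists (y %/ n').+1.
    by rewrite /= ltn_divLR // mulnC -nE.
  by rewrite /= -e -divn_eq.
- move/eqP; rewrite muln_eq0 [(d == 0)%N]eqn0Ngt d0 orbF => /eqP->.
  by rewrite muln0 mod0n.
Qed.

(* Main.v *)
(* Modulo relK m j the Laurent polynomial relK m (k j mod n), evaluated at x^k,
   vanishes.  Hence the (m, j) component of psi^k(w) is obtained from the
   (m, k j mod n) component of w by substituting x^k for x and multiplying by the
   twisting factor of A_m, so psi^k moves the summand (m, l) to the summands
   (m, j) with k j = l mod n.  For m <> 0 the factor is there the
   geometric sum of the powers of zeta^(-j), and on the summand (0, 0) one has
   x^k = 1 + k (x - 1) modulo (x - 1)^2. *)
Require Import Defs.
From mathcomp Require Import all_boot all_order all_algebra.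
From mathcomp Require Import complex reals.
From mathcomp Require Import boolp ring.

Set Implicit Arguments.
Unset Strict Implicit.
Unset Printing Implicit Defensive.

Import GRing.Theory.
Local Open Scope ring_scope.

(** * Congruences for powers of [x] modulo the relations [relK] *)

Section Congruences.
Variables (F : fieldType) (z : F).

Lemma subst_alg k (c : F) : subst k c%:A = c%:A :> laurent F.
Proof. by rewrite -[c%:A]addr0 substP subst1 subst0. Qed.

Lemma xpow_nat (k : nat) : xpow k = xpow 1 ^+ k :> laurent F.
Proof. by rewrite -xpowMn mul1r. Qed.

Lemma relK_N00 m l : ~~ ((m == 0%N) && (l == 0%N)) ->
  relK z m l = xpow 1 - (z ^+ l)%:A.
Proof. by rewrite /relK => /negPf->. Qed.

(** The factorization of [x^k - a^k] by [x - a], which links the relation at [k j] to the relation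
    at [j]. *)
Lemma subst_subX1_alg k (a : F) :
  exists h, subst k (xpow 1 - (a ^+ k)%:A) = h * (xpow 1 - a%:A).
Proof.
rewrite substB substX mulr1 subst_alg xpow_nat.
have -> : (a ^+ k)%:A = a%:A ^+ k :> laurent F by rewrite exprZn expr1n.
by rewrite subrXX mulrC; eexists.
Qed.

Lemma cls_xpow1 m j : ~~ ((m == 0%N) && (j == 0%N)) ->
  cls (relK z m j) (xpow 1) = cls (relK z m j) (z ^+ j)%:A.
Proof.
move=> h; apply/cls_eqP/principalP; exists 1.
by rewrite relK_N00 // mul1r.
Qed.

Lemma cls_xpow_nat m j k : ~~ ((m == 0%N) && (j == 0%N)) ->
  cls (relK z m j) (xpow k%:Z) = cls (relK z m j) (z ^+ (k * j))%:A.
Proof.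
move=> h; rewrite xpow_nat rmorphXn /= cls_xpow1 // -rmorphXn /=.
by rewrite exprZn expr1n -exprM mulnC.
Qed.

Lemma cls_xpowN m j i : z != 0 -> ~~ ((m == 0%N) && (j == 0%N)) ->
  cls (relK z m j) (xpow (- i%:Z)) = cls (relK z m j) ((z ^- j) ^+ i)%:A.
Proof.
move=> z0 h; rewrite -[LHS]mul1r.
(* The unit is split into a scalar times the class of [x^i], which then cancels [x^(-i)]. *)
have -> : 1 = cls (relK z m j) ((z ^- j) ^+ i)%:A * cls (relK z m j) (xpow i%:Z).
  rewrite cls_xpow_nat // -rmorphM /= -scalerAl mul1r scalerA.
  by rewrite mulnC exprM exprVn mulVf ?scale1r ?rmorph1 // !expf_neq0.
by rewrite -mulrA -[X in _ * X]rmorphM -xpowD subrr xpow0 rmorph1 mulr1.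
Qed.

Lemma xpow_tangent k : exists h : laurent F,
  xpow k%:Z - (k%:R *: xpow 1 - (k%:R - 1) *: 1) = h * (xpow 1 - 1) ^+ 2.
Proof.
rewrite xpow_nat; set x := xpow 1.
have e j : j%:R *: x - (j%:R - 1) *: 1 = j%:R * x - (j%:R - 1) :> laurent F.
  by rewrite scalerBl scale1r !scaler_nat mulr_natl.
rewrite e; elim: k => [|k [h hk]]; first by exists 0; rewrite expr0; ring.
(* [x] times the tangent [k x - (k-1)] exceeds the next tangent [(k+1) x - k] by [k (x-1)^2]. *)
exists (x * h + k%:R); rewrite mulrDl -mulrA -hk exprS -natr1; ring.
Qed.

End Congruences.

(** A lift to Laurent polynomials of the factor in [adams_xA], so that it can be reduced modulo
    every [relK]. *)
Definition twist (F : fieldType) (k m : nat) : laurent F :=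
  if m == 0%N then 1 else \sum_(i < k) xpow (- i%:Z).

(** * Components of the transported Adams operations *)

Section AdamsComponents.
Variables (F : fieldType) (n : nat) (z : F).
Hypothesis z_prim : n.-primitive_root z.

Lemma prim_root_neq0 : z != 0.
Proof.
apply/eqP => z0; have := prim_expr_order z_prim.
have := prim_order_gt0 z_prim.
by rewrite z0 expr0n; case: (n) => // ? _ /eqP; rewrite eq_sym oner_eq0.
Qed.

Lemma prim_root_neq1 j : (0 < j < n)%N -> z ^+ j != 1.
Proof.
move=> /andP[j0 jn]; rewrite -(prim_order_dvd z_prim).
by apply/negP => /(dvdn_leq j0); rewrite leqNgt jn.
Qed.

Lemma expr_prim_modn i j : i = j %[mod n] -> z ^+ i = z ^+ j.
Proof. by move=> e; rewrite -(prim_expr_mod z_prim) e prim_expr_mod. Qed.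

Lemma subst_relK k m j (h : laurent F) :
  h \in principal (relK z m (k * j %% n)) ->
  subst k h \in principal (relK z m j).
Proof.
move=> /principalP[g ->]; rewrite substM; apply: principalM.
have [h1 e1] := subst_subX1_alg k (z ^+ j).
have zE : (z ^+ j) ^+ k = z ^+ (k * j %% n).
  by rewrite prim_expr_mod // -exprM mulnC.
rewrite zE in e1; apply/principalP.
(* Only the double relation at (0, 0) is special: its substitute contains [(x - z^j)^2], which
   suffices both for [j = 0], where the target is double, and for [j != 0], where it is simple. *)
have [|N00] := boolP ((m == 0%N) && (k * j %% n == 0)%N); last first.
  rewrite relK_N00 // e1 relK_N00; first by exists h1.
  by apply: contra N00 => /andP[-> /eqP->]; rewrite muln0 mod0n.
move=> /andP[/eqP-> /eqP l0].
rewrite l0 expr0 scale1r in e1.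
rewrite l0 [relK z 0 0]/relK !eqxx /= expr2 substM e1.
have [->|j0] := eqVneq j 0%N; last first.
  by rewrite relK_N00 // mulrA; eexists.
by rewrite expr0 scale1r /relK /= expr2 mulrACA; eexists.
Qed.

(** Any representatives [g] of the components of [w] may be used: by [subst_relK], substitution
    turns their congruence with the preimage under [Gamma] at [k j mod n] into one at [j]. *)
Lemma adams_component k (w : KK n z) (g : nat -> nat -> laurent F) :
  (forall m l : 'I_n, w (m, l) = cls (relK z m l) (g m l)) ->
  forall m j : 'I_n, adams n z k w (m, j) =
    cls (relK z m j) (subst k (g m (k * j %% n)%N) * twist F k m).
Proof.
move=> wE m j; rewrite /adams /=; set u := Gamma_inv w.
have uw : Gamma z u = w by case: (Gamma_invK z_prim) => _; apply.
have -> : adamsKI k u =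
    fun m' : 'I_n => cls (relA F n m') (subst k (lrepr (u m')) * twist F k m').
  apply: functional_extensionality_dep => m'; rewrite /adamsKI /adamsA adams_xAE.
  by rewrite rmorphM /= /twist; case: ifP => _; rewrite ?rmorph1 ?rmorph_sum.
rewrite (Gamma_cls z_prim) /= !rmorphM /=; congr (_ * _).
apply/cls_eqP; rewrite -substB; apply: subst_relK; apply/cls_eqP.
have ln : (k * j %% n < n)%N by rewrite ltn_pmod // (prim_order_gt0 z_prim).
by rewrite -(wE m (Ordinal ln)) -uw.
Qed.

Lemma adams_inK k m l (f : laurent F) (m' j : 'I_n) : (l < n)%N ->
  adams n z k (inK n z m l f) (m', j) =
  cls (relK z m' j)
    (if (m' == m :> nat) && (k * j == l %[mod n])
     then subst k f * twist F k m else 0).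
Proof.
move=> ln; rewrite (@adams_component k _
  (fun a b => if (a == m) && (b == l) then f else 0)) //.
rewrite (modn_small ln); case: eqP => [->|_] /=; last by rewrite subst0 mul0r.
by case: ifP => _ //; rewrite subst0 mul0r.
Qed.

(** * Sums over the solutions of [k y = l] modulo [n] *)

Lemma KK_sumE (I : Type) (r : seq I) (P : pred I) (w : I -> KK n z) ml :
  (\sum_(i <- r | P i) w i) ml = \sum_(i <- r | P i) w i ml.
Proof. by elim/big_rec2: _ => // i a b _ <-. Qed.

Lemma scale_inK (c : F) m l (f : laurent F) :
  c *: inK n z m l f = inK n z m l (c *: f).
Proof.
apply: functional_extensionality_dep => ml.
transitivity (c *: inK n z m l f ml) => //.
rewrite /inK; case: ifP => _; first by rewrite -linearZ.
by rewrite !raddf0.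
Qed.

Lemma inKB m l (f g : laurent F) :
  inK n z m l (f - g) = inK n z m l f - inK n z m l g.
Proof.
apply: functional_extensionality_dep => ml.
transitivity (inK n z m l f ml - inK n z m l g ml) => //.
by rewrite /inK -raddfB; case: ifP => _ //; rewrite subr0.
Qed.

(** Since [s] lists each solution once, exactly one term survives at a solution [j] in row [m], and
    none elsewhere. *)
Lemma sum_solutions k l (s : nat -> nat) m (g : nat -> laurent F)
    (m' j : 'I_n) :
  solutions n k l s ->
  (\sum_(1 <= i < (gcdn k n).+1) inK n z m (s i) (g (s i))) (m', j) =
  cls (relK z m' j)
    (if (m' == m :> nat) && (k * j == l %[mod n]) then g j else 0).
Proof.
move=> [s_sol s_inj s_all _]; rewrite KK_sumE.
case: (boolP (_ && _)) => [/andP[m'm /eqP kj]|N]; last first.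
  rewrite raddf0 big_nat big1 // => i; rewrite ltnS => /s_sol[_ ksi].
  rewrite /inK /=; case: ifP => [/andP[/eqP mm /eqP js]|_]; last exact: raddf0.
  by move: N; rewrite mm js ksi !eqxx.
have [i0 i0d si0] := s_all j (ltn_ord j) kj.
rewrite (bigD1_seq i0) ?iota_uniq ?mem_index_iota //=.
rewrite {1}/inK /= m'm si0 eqxx /= big_nat_cond big1 ?addr0 //.
move=> i /andP[]; rewrite ltnS => id ni.
rewrite /inK /= -si0 [s i0 == _](_ : _ = false) ?andbF ?raddf0 //.
apply/negP => /eqP /s_inj e; move: ni; rewrite e ?eqxx //.
Qed.

(** Reduces a formula for [adams] to one congruence modulo [relK z m j] for each solution [j]. *)
Lemma adams_inK_sum k l s m (f : laurent F) (g : nat -> laurent F) :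
  (l < n)%N -> solutions n k l s ->
  (forall j : nat, (j < n)%N -> k * j = l %[mod n] ->
    cls (relK z m j) (subst k f * twist F k m) = cls (relK z m j) (g j)) ->
  adams n z k (inK n z m l f) =
  \sum_(1 <= i < (gcdn k n).+1) inK n z m (s i) (g (s i)).
Proof.
move=> ln ss fg; apply: functional_extensionality_dep => -[m' j].
rewrite (@sum_solutions k l) // adams_inK //.
by case: ifP => // /andP[/eqP-> /eqP kj]; apply: fg.
Qed.

Lemma adams_inK_eq0 k m l (f : laurent F) : (l < n)%N ->
  ~~ (gcdn k n %| l)%N -> adams n z k (inK n z m l f) = 0.
Proof.
move=> ln Nd; apply: functional_extensionality_dep => -[m' j].
rewrite adams_inK //; case: ifP => [/andP[_ /eqP e]|_]; last exact: raddf0.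
(* The gcd divides both [k j] and [n], so a solvable congruence forces it to divide [l]. *)
case/negP: Nd; rewrite -(modn_small ln) -e.
by rewrite /dvdn modn_dvdm ?dvdn_gcdr // -/(dvdn _ _) dvdn_mulr ?dvdn_gcdl.
Qed.

(** * The twisting factor and the values on the generators *)

Lemma cls_twist k m j : m != 0%N ->
  cls (relK z m j) (twist F k m) =
  cls (relK z m j) (\sum_(i < k) (z ^- j) ^+ i)%:A.
Proof.
move=> m0; rewrite /twist (negPf m0) scaler_suml !rmorph_sum /=.
by apply: eq_bigr => i _; rewrite cls_xpowN ?prim_root_neq0 // (negPf m0).
Qed.

(** A geometric sum with ratio [z^(-j)], different from 1, whose [k]-th power is [z^(-l)]. *)
Lemma sum_exprV k l j : (0 < j < n)%N -> k * j = l %[mod n] ->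
  \sum_(i < k) (z ^- j) ^+ i = (z ^- l - 1) / (z ^- j - 1).
Proof.
move=> /prim_root_neq1 zj e.
have nz : z ^- j - 1 != 0 by rewrite subr_eq0 invr_eq1.
apply: (canRL (mulfK nz)); rewrite mulrC -subrX1; congr (_ - 1).
by rewrite exprVn -exprM mulnC (expr_prim_modn e).
Qed.

(** In row 0 the twist is 1 and substitution fixes 1, for [l = 0] as well. *)
Lemma adams_oneK0 k l s : (l < n)%N -> solutions n k l s ->
  adams n z k (oneK n z 0 l) =
  \sum_(1 <= i < (gcdn k n).+1) oneK n z 0 (s i).
Proof.
move=> ln ss; apply: (@adams_inK_sum k l s 0 1 (fun=> 1)) => // j _ _.
by rewrite subst1 mul1r.
Qed.

Lemma adams_oneK k m l s : m != 0%N -> (0 < l < n)%N -> solutions n k l s ->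
  adams n z k (oneK n z m l) =
  \sum_(1 <= i < (gcdn k n).+1)
    ((z ^- l - 1) / (z ^- (s i) - 1)) *: oneK n z m (s i).
Proof.
move=> m0 /andP[l0 ln] ss; under eq_bigr do rewrite scale_inK.
apply: (@adams_inK_sum k l s m 1
  (fun j => ((z ^- l - 1) / (z ^- j - 1))%:A)) => // j jn kj.
rewrite subst1 mul1r cls_twist // (sum_exprV _ kj) // jn andbT lt0n.
(* A solution [j = 0] would give [l = 0], so the denominator does not vanish. *)
by apply: contraTneq l0 => j0; rewrite -(modn_small ln) -kj j0 muln0 mod0n.
Qed.

(** At [j = 0] the geometric sum has [k] terms equal to 1; at every other solution it vanishes, its
    numerator being [z^0 - 1]. *)
Lemma adams_oneKm0 k m : m != 0%N ->
  adams n z k (oneK n z m 0) = k%:R *: oneK n z m 0.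
Proof.
have n0 := prim_order_gt0 z_prim.
move=> m0; apply: functional_extensionality_dep => -[m' j].
rewrite scale_inK adams_inK // /inK /=.
case: eqP => [m'm|_] //=; rewrite subst1 mul1r m'm.
have [->|j0] := eqVneq (j : nat) 0%N.
  rewrite muln0 eqxx cls_twist // expr0 invr1.
  by under eq_bigr do rewrite expr1n; rewrite sumr_const card_ord.
case: eqP => // kj; rewrite cls_twist // (sum_exprV _ kj) ?lt0n ?j0 ?ltn_ord //.
by rewrite expr0 invr1 subrr mul0r scale0r.
Qed.

Lemma adams_x00 k s : (0 < k)%N -> solutions n k 0 s ->
  adams n z k (x00 n z) =
  k%:R *: x00 n z - (k%:R - 1) *: oneK n z 0 0
  + \sum_(2 <= i < (gcdn k n).+1) oneK n z 0 (s i).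
Proof.
move=> k0 ss; have [_ s_inj _ /(_ erefl) s1] := ss.
have n0 := prim_order_gt0 z_prim.
have d0 : (0 < gcdn k n)%N by rewrite gcdn_gt0 k0.
(* The tangent of [x^k] at 1 represents it modulo the double relation; at a solution [j != 0], [x^k]
   reduces to [z^(k j) = 1]. *)
pose g j : laurent F :=
  if j == 0%N then k%:R *: xpow 1 - (k%:R - 1) *: 1 else 1.
rewrite /x00 /oneK !scale_inK -inKB.
transitivity (\sum_(1 <= i < (gcdn k n).+1) inK n z 0 (s i) (g (s i))); last first.
  (* The term [i = 1] carries the tangent because [s 1 = 0]; injectivity makes [s i] nonzero for
     [i >= 2]. *)
  rewrite big_ltn // s1; congr (_ + _); apply: eq_big_nat => i /andP[i2 id].
  rewrite /g; case: eqP => // si; have i1 : i = 1%N; last by rewrite i1 in i2.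
  by apply: s_inj; rewrite ?inE ?d0 // ?si ?s1 // (ltnW i2).
apply: adams_inK_sum => // j jn kj.
rewrite /twist eqxx mulr1 substX mulr1 /g; case: eqVneq => [->|j0].
  by apply/cls_eqP/principalP; rewrite /relK /=; apply: xpow_tangent.
by rewrite cls_xpow_nat // (expr_prim_modn kj) expr0 scale1r.
Qed.

End AdamsComponents.

(** * Specialization to the complex root of unity [zeta R n] *)

Theorem proposition6p1 (R : realType) (n k l : nat)
  (hn : (2 <= n)%N) (hk : (1 <= k)%N) (hl : (l < n)%N) :
  let z : R[i] := zeta R n in
  let d := gcdn k n in
  let psi : KK n z -> KK n z := adams n z k in
  [/\ (* 1 *)
      l <> 0%N ->
        ((d %| l)%N -> forall s, solutions n k l s ->
          psi (oneK n z 0 l) = \sum_(1 <= i < d.+1) oneK n z 0 (s i)) /\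
        (~~ (d %| l)%N -> psi (oneK n z 0 l) = 0),
      (* 2 *)
      forall m : nat, (m < n)%N -> m <> 0%N -> l <> 0%N ->
        ((d %| l)%N -> forall s, solutions n k l s ->
          psi (oneK n z m l) =
            \sum_(1 <= i < d.+1)
              ((z ^- l - 1) / (z ^- (s i) - 1)) *: oneK n z m (s i)) /\
        (~~ (d %| l)%N -> psi (oneK n z m l) = 0),
      (* 3 *)
      forall m : nat, (m < n)%N -> m <> 0%N ->
        psi (oneK n z m 0) = k%:R *: oneK n z m 0,
      (* 4 *)
      forall s, solutions n k 0 s ->
        psi (oneK n z 0 0) = \sum_(1 <= i < d.+1) oneK n z 0 (s i)
    & (* 5 *)
      forall s, solutions n k 0 s ->
        psi (x00 n z) =
          k%:R *: x00 n z - (k%:R - 1) *: oneK n z 0 0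
          + \sum_(2 <= i < d.+1) oneK n z 0 (s i)].
Proof.
move=> z d psi.
have z_prim : n.-primitive_root z by apply: zeta_prim; apply: ltnW.
have n0 : (0 < n)%N by apply: ltnW.
split.
- by move=> _; split=> [_ s|]; [apply: adams_oneK0 | apply: adams_inK_eq0].
- move=> m _ /eqP m0 /eqP l0; split=> [_ s|]; last exact: adams_inK_eq0.
  by apply: adams_oneK => //; rewrite lt0n l0.
- by move=> m _ /eqP; apply: adams_oneKm0.
- by move=> s; apply: adams_oneK0.
by move=> s; apply: adams_x00.
Qed.
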